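(* Let $\Gamma$ be a set and $\{(A_\gamma,\rho_\gamma,\mathbb{B}_\gamma)\mid\gamma\in\Gamma\}$ be a family of CLCAs. Let $(A,\rho,\mathbb{B})=\prod\{(A_\gamma,\rho_\gamma,\mathbb{B}_\gamma)\mid\gamma\in\Gamma\}$ be their product (as defined in the context) and, for every $\gamma\in\Gamma$ and every $a=(a_\gamma)_{\gamma\in\Gamma}\in A$, put $\pi_\gamma(a)=a_\gamma$. Then the source $\{\pi_\gamma:(A,\rho,\mathbb{B})\to(A_\gamma,\rho_\gamma,\mathbb{B}_\gamma)\mid\gamma\in\Gamma\}$ is a product of the family $\{(A_\gamma,\rho_\gamma,\mathbb{B}_\gamma)\mid\gamma\in\Gamma\}$ in the category $\mathbf{DLC}$.
   Context: Boolean algebras may be degenerate ($0=1$ allowed); the complement of $a$ is written $a^*$. A contact relation on a Boolean algebra $A$ is a binary relation $\rho$ such that: $a\neq 0$ implies $a\rho a$; $a\rho b$ implies $a\ne 0$ and $b\neq 0$; $a\rho b$ implies $b\rho a$; $a\rho(b\vee c)$ iff ($a\rho b$ or $a\rho c$). Write $a\ll_\rho b$ iff not $a\,\rho\, b^*$. A local contact algebra (LCA) is a triple $(A,\rho,\mathbb{B})$ where $A$ is a Boolean algebra, $\rho$ is a contact relation on $A$ and $\mathbb{B}$ is an ideal of $A$ (possibly $\mathbb B=A$) such that (BC1) if $a\in\mathbb{B}$, $c\in A$ and $a\ll_\rho c$ then $a\ll_\rho b\ll_\rho c$ for some $b\in\mathbb{B}$; (BC2) if $a\rho b$ then there is $c\in\mathbb{B}$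 with $a\rho(c\wedge b)$; (BC3) if $a\neq 0$ then there is $b\in\mathbb{B}\setminus\{0\}$ with $b\ll_\rho a$. A complete local contact algebra (CLCA) is an LCA $(A,\rho,\mathbb{B})$ with $A$ a complete Boolean algebra. $\mathbf{DLC}$ is the category whose objects are all CLCAs and whose morphisms $\varphi:(A,\rho,\mathbb{B})\to(B,\eta,\mathbb{B}')$ are all functions $\varphi:A\to B$ such that (DLC1) $\varphi(0)=0$; (DLC2) $\varphi(a\wedge b)=\varphi(a)\wedge\varphi(b)$ for all $a,b\in A$; (DLC3) if $a\in\mathbb{B}$, $b\in A$ and $a\ll_\rho b$ then $(\varphi(a^* ))^*\ll_\eta\varphi(b)$; (DLC4) for every $b\in\mathbb{B}'$ there is $a\in\mathbb{B}$ with $b\le\varphi(a)$; (DLC5) $\varphi(a)=\bigvee\{\varphi(b)\mid b\in\mathbb{B},\ b\ll_\rho a\}$ for every $a\in A$. The composition of $\varphi_1:(A_1,\rho_1,\mathbb{B}_1)\to(A_2,\rho_2,\mathbb{B}_2)$ and $\varphi_2:(A_2,\rho_2,\mathbb{B}_2)\to(A_3,\rho_3,\mathbb{B}_3)$ is $(\varphi_2\diamond\varphi_1)(a)=\bigvee\{\varphi_2(\varphi_1(b))\mid b\in\mathbb{B}_1,\ b\ll_{\rho_1}a\}$; identities are identity functions. The product $\prod\{(A_\gamma,\rho_\gamma,\mathbb{B}_\gamma)\mid\gamma\in\Gamma\}$ of a family of LCAs is the triple $(A,\rho,\mathbb{B})$ where $A=\prod_{\gamma\in\Gamma}A_\gamma$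 is the Cartesian product with coordinate-wise Boolean operations, $\mathbb{B}=\{(b_\gamma)_{\gamma\in\Gamma}\in\prod_{\gamma\in\Gamma}\mathbb{B}_\gamma\mid\{\gamma\in\Gamma\mid b_\gamma\neq 0\}\text{ is finite}\}$, and $a\rho b$ iff there exists $\gamma\in\Gamma$ with $a_\gamma\rho_\gamma b_\gamma$. *)

(* Defs.v *)
From HB Require Import structures.
From mathcomp Require Import all_boot all_order.
From mathcomp Require Import all_classical.

Set Implicit Arguments.
Unset Strict Implicit.
Unset Printing Implicit Defensive.

Import Order.Theory.
Local Open Scope classical_set_scope.
Local Open Scope order_scope.

Record category := Category {
  ob :> Type;
  hom : ob -> ob -> Type;
  idm : forall X, hom X X;
  comp : forall X Y Z, hom Y Z -> hom X Y -> hom X Z;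
  comp_idl : forall X Y (f : hom X Y), comp (idm Y) f = f;
  comp_idr : forall X Y (f : hom X Y), comp f (idm X) = f;
  comp_assoc : forall X Y Z T (h : hom Z T) (g : hom Y Z) (f : hom X Y),
    comp h (comp g f) = comp (comp h g) f }.

Arguments hom {c} _ _.
Arguments idm {c} _.
Arguments comp {c X Y Z} _ _.

Definition is_product (C : category) (I : Type) (A : I -> C)
    (P : C) (p : forall i, hom P (A i)) : Prop :=
  forall (X : C) (f : forall i, hom X (A i)),
    exists! h : hom X P, forall i, comp (p i) h = f i.

(* Boolean algebras are [ctbDistrLatticeType]s, which may be degenerate:
   [\bot = \top] is allowed. *)

Definition complete_lattice d (A : porderType d) : Prop :=
  forall S : set A, supremums S !=set0.

(* The least upper bound of [S] if there is one; [bjoin set0 = \bot]. *)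
Definition bjoin d (A : bPOrderType d) (S : set A) : A := supremum \bot S.

(* An alias of the dependent function type, needed because the library already
   gives [I -> T] a lattice structure, with another display. *)
Definition ba_prod (I : Type) (d : I -> Order.disp_t)
  (K : forall i, ctbDistrLatticeType (d i)) : Type := forall i, K i.

Section BooleanProduct.
Variables (I : Type) (d : I -> Order.disp_t).
Variable K : forall i, ctbDistrLatticeType (d i).
Local Notation T := (ba_prod K).
Implicit Types x y z : T.

HB.instance Definition _ := gen_eqMixin T.
HB.instance Definition _ := gen_choiceMixin T.

Definition ba_prod_le x y := `[< forall i, x i <= y i >].
Definition ba_prod_meet x y : T := fun i => x i `&` y i.
Definition ba_prod_join x y : T := fun i => x i `|` y i.
Definition ba_prod_compl x : T := fun i => ~` x i.

Fact ba_prod_le_refl : reflexive ba_prod_le.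
Proof. by move=> x; apply/asboolP => i. Qed.

Fact ba_prod_le_anti : antisymmetric ba_prod_le.
Proof.
move=> x y /andP[/asboolP xy /asboolP yx]; apply: functional_extensionality_dep.
by move=> i; apply/le_anti; rewrite xy yx.
Qed.

Fact ba_prod_le_trans : transitive ba_prod_le.
Proof.
move=> y x z /asboolP xy /asboolP yz; apply/asboolP => i.
exact: le_trans (xy i) (yz i).
Qed.

HB.instance Definition _ := Order.Le_isPOrder.Build Order.default_display T
  ba_prod_le_refl ba_prod_le_anti ba_prod_le_trans.

Let ext x y : (forall i, x i = y i) -> x = y.
Proof. exact: functional_extensionality_dep. Qed.

Fact ba_prod_meetC : commutative ba_prod_meet.
Proof. by move=> x y; apply: ext => i; exact: meetC. Qed.
Fact ba_prod_joinC : commutative ba_prod_join.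
Proof. by move=> x y; apply: ext => i; exact: joinC. Qed.
Fact ba_prod_meetA : associative ba_prod_meet.
Proof. by move=> x y z; apply: ext => i; exact: meetA. Qed.
Fact ba_prod_joinA : associative ba_prod_join.
Proof. by move=> x y z; apply: ext => i; exact: joinA. Qed.
Fact ba_prod_joinKI y x : ba_prod_meet x (ba_prod_join x y) = x.
Proof. by apply: ext => i; exact: joinKI. Qed.
Fact ba_prod_meetKU y x : ba_prod_join x (ba_prod_meet x y) = x.
Proof. by apply: ext => i; exact: meetKU. Qed.
Fact ba_prod_leEmeet x y : (x <= y) = (ba_prod_meet x y == x).
Proof.
apply/asboolP/eqP => [xy|<- i]; last exact: leIr.
by apply: ext => i; exact/meet_l/xy.
Qed.
Fact ba_prod_meetUl : left_distributive ba_prod_meet ba_prod_join.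
Proof. by move=> x y z; apply: ext => i; exact: meetUl. Qed.

HB.instance Definition _ :=
  Order.POrder_Meet_isDistrLattice.Build Order.default_display T
    ba_prod_meetC ba_prod_joinC ba_prod_meetA ba_prod_joinA
    ba_prod_joinKI ba_prod_meetKU ba_prod_leEmeet ba_prod_meetUl.

Definition ba_prod_bot : T := fun i => \bot.
Definition ba_prod_top : T := fun i => \top.

Fact ba_prod_le0x x : ba_prod_bot <= x.
Proof. by apply/asboolP => i; exact: le0x. Qed.
Fact ba_prod_lex1 x : x <= ba_prod_top.
Proof. by apply/asboolP => i; exact: lex1. Qed.

HB.instance Definition _ :=
  Order.hasBottom.Build Order.default_display T ba_prod_le0x.
HB.instance Definition _ :=
  Order.hasTop.Build Order.default_display T ba_prod_lex1.

Fact ba_prod_joinxC x : x `|` ba_prod_compl x = \top.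
Proof. by apply: ext => i; exact: joinxC. Qed.
Fact ba_prod_meetxC x : x `&` ba_prod_compl x = \bot.
Proof. by apply: ext => i; exact: meetxC. Qed.

HB.instance Definition _ :=
  Order.TBDistrLattice_hasComplement.Build Order.default_display T
    ba_prod_joinxC ba_prod_meetxC.

End BooleanProduct.

(* A triple (A, rho, B) on which no axiom is imposed. *)
Record contact_triple := ContactTriple {
  ct_disp : Order.disp_t;
  ct_alg :> ctbDistrLatticeType ct_disp;
  contact : ct_alg -> ct_alg -> Prop;
  bounded : set ct_alg }.

Arguments contact {c} _ _.
Arguments bounded {c} _.

Definition well_inside (X : contact_triple) (a b : X) : Prop :=
  ~ contact a (~` b)%O.

Local Notation "a ≪ b" := (well_inside a b) (at level 70, no associativity).

Record is_contact d (A : ctbDistrLatticeType d) (rho : A -> A -> Prop) : Prop := {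
  contact_refl : forall a, a != \bot -> rho a a;
  contact_neq0 : forall a b, rho a b -> a != \bot /\ b != \bot;
  contact_sym : forall a b, rho a b -> rho b a;
  contact_join : forall a b c, rho a (b `|` c)%O <-> rho a b \/ rho a c }.

Record is_ideal d (A : bLatticeType d) (J : set A) : Prop := {
  ideal_bot : J \bot;
  ideal_down : forall a b, J b -> a <= b -> J a;
  ideal_join : forall a b, J a -> J b -> J (a `|` b)%O }.

Record is_LCA (X : contact_triple) : Prop := {
  lca_contact : is_contact (@contact X);
  lca_ideal : is_ideal (@bounded X);
  BC1 : forall a c : X, bounded a -> a ≪ c ->
    exists b : X, [/\ bounded b, a ≪ b & b ≪ c];
  BC2 : forall a b : X, contact a b ->
    exists c : X, bounded c /\ contact a (c `&` b)%O;
  BC3 : forall a : X, a != \bot ->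
    exists b : X, [/\ bounded b, b != \bot & b ≪ a] }.

Record is_CLCA (X : contact_triple) : Prop := {
  clca_lca : is_LCA X;
  clca_complete : complete_lattice X }.

Record CLCA := MkCLCA {
  clca_triple :> contact_triple;
  clcaP : is_CLCA clca_triple }.

Definition lca_prod (I : Type) (A : I -> contact_triple) : contact_triple :=
  @ContactTriple _ (ba_prod (fun i => ct_alg (A i)))
    (fun a b => exists i, contact (a i) (b i))
    [set b | (forall i, bounded (b i)) /\ finite_set [set i | b i != \bot]].

Definition lca_proj (I : Type) (A : I -> contact_triple) (i : I) :
  lca_prod A -> A i := fun a => a i.

Record is_DLC_morphism (X Y : contact_triple) (phi : X -> Y) : Prop := {
  DLC1 : phi \bot = \bot;
  DLC2 : forall a b : X, phi (a `&` b)%O = (phi a `&` phi b)%O;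
  DLC3 : forall a b : X, bounded a -> a ≪ b -> (~` phi (~` a))%O ≪ phi b;
  DLC4 : forall b : Y, bounded b -> exists a : X, bounded a /\ b <= phi a;
  DLC5 : forall a : X,
    phi a = bjoin [set phi b | b in [set b : X | bounded b /\ b ≪ a]] }.

Record DLC_hom (X Y : CLCA) := MkDLCHom {
  DLC_fun :> X -> Y;
  DLC_homP : is_DLC_morphism DLC_fun }.

Definition DLC_comp_fun (X Y Z : contact_triple) (psi : Y -> Z) (phi : X -> Y) :
    X -> Z :=
  fun a => bjoin [set psi (phi b) | b in [set b : X | bounded b /\ b ≪ a]].

Section JoinTheory.
Variables (d : Order.disp_t) (A : ctbDistrLatticeType d).
Hypothesis cA : complete_lattice A.
Implicit Types S : set A.

Lemma bjoin_supremums S : supremums S (bjoin S).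
Proof.
rewrite /bjoin /supremum; case: ifPn => [/eqP ->|_].
  by split => [x //|x _]; exact: le0x.
have [y Sy] := cA S; case: xgetP => [z -> //|/(_ y)]; exact.
Qed.

Lemma bjoin_ub S a : S a -> a <= bjoin S.
Proof. by have [+ _] := bjoin_supremums S; exact. Qed.

Lemma bjoin_le S u : (forall a, S a -> a <= u) -> bjoin S <= u.
Proof. by have [_ +] := bjoin_supremums S; exact. Qed.

Lemma meet_leL (x y z : A) : (x `&` y <= z) = (x <= ~` y `|` z).
Proof. by rewrite -leBLR diffE complK. Qed.

Lemma bjoin_meet S a u : (forall s, S s -> s `&` a <= u) -> bjoin S `&` a <= u.
Proof. by move=> H; rewrite meet_leL; apply: bjoin_le => s /H; rewrite meet_leL. Qed.

Lemma bjoin_meet2 S1 S2 u : (forall s t, S1 s -> S2 t -> s `&` t <= u) ->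
  bjoin S1 `&` bjoin S2 <= u.
Proof.
move=> H; apply: bjoin_meet => s Ss; rewrite meetC; apply: bjoin_meet => t St.
by rewrite meetC; exact: H.
Qed.

End JoinTheory.

Section ContactTheory.
Variable X : contact_triple.
Hypothesis lX : is_LCA X.
Implicit Types a b c u : X.

Let cX := lca_contact lX.
Let iX := lca_ideal lX.

Lemma contact_mono a b u c : contact a b -> a <= u -> b <= c -> contact u c.
Proof.
have monoR (x y z : X) : contact x y -> y <= z -> contact x z.
  by move=> xy /join_r <-; apply/(contact_join cX); left.
move=> ab au bc; apply: (monoR _ b) => //.
by apply: (contact_sym cX); apply: (monoR _ a) => //; exact: (contact_sym cX).
Qed.

Lemma well_inside_mono u a b c : u <= a -> a ≪ b -> b <= c -> u ≪ c.
Proof. by move=> ua ab bc uc; apply: ab; apply: contact_mono uc _ _; rewrite ?leC. Qed.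

Lemma well_inside_le a b : a ≪ b -> a <= b.
Proof.
move=> ab; rewrite -[b]complK -disj_leC; apply/negPn/negP => /(contact_refl cX) H.
by apply: ab; apply: contact_mono H _ _; rewrite ?leIl ?leIr.
Qed.

Lemma well_inside_compl a b : a ≪ b -> ~` b ≪ ~` a.
Proof. by move=> ab H; apply: ab; apply: (contact_sym cX); rewrite -[a]complK. Qed.

Lemma well_inside_meet a b c : a ≪ b -> a ≪ c -> a ≪ b `&` c.
Proof. by move=> ab ac; rewrite /well_inside complI => /(contact_join cX)[]. Qed.

Lemma well_inside_top a : a ≪ \top.
Proof. by rewrite /well_inside compl1 => /(contact_neq0 cX)[_]; rewrite eqxx. Qed.

Lemma well_inside_bot a : a ≪ \bot -> a = \bot.
Proof. by move=> /well_inside_le; rewrite lex0 => /eqP. Qed.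

Lemma bot_well_inside a : \bot ≪ a.
Proof. by move=> /(contact_neq0 cX)[]; rewrite eqxx. Qed.

Lemma bounded_meetl a b : bounded a -> bounded (a `&` b).
Proof. by move=> Ba; apply: (ideal_down iX) Ba _; exact: leIl. Qed.

End ContactTheory.

Section MorphismTheory.
Variables (X Y : contact_triple) (phi : X -> Y).
Hypotheses (lX : is_LCA X) (lY : is_CLCA Y) (mphi : is_DLC_morphism phi).

Let lY' := clca_lca lY.

Lemma DLC_mono a b : a <= b -> phi a <= phi b.
Proof. by move=> /meet_l <-; rewrite (DLC2 mphi) leIr. Qed.

Lemma DLC_compl_le a : phi a <= ~` phi (~` a).
Proof. by rewrite -disj_leC -(DLC2 mphi) meetxC (DLC1 mphi). Qed.

(* (DLC3) holds without the boundedness assumption. *)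
Lemma DLC3_strong a b : a ≪ b -> ~` phi (~` a) ≪ phi b.
Proof.
move=> ab H.
have [c [Bc]] := BC2 lY' H.
move=> /(contact_sym (lca_contact lY'))/(BC2 lY')[c' [Bc']].
move=> /(contact_sym (lca_contact lY')) {}H.
have [e [Be lee]] := DLC4 mphi (ideal_join (lca_ideal lY') Bc Bc').
have {lee} c'e : c' <= phi e by apply: le_trans lee; exact: leUr.
have aeb : a `&` e ≪ b by apply: well_inside_mono ab _; rewrite ?leIl.
apply: (DLC3 mphi _ aeb); first by rewrite meetC; exact: bounded_meetl.
apply: (contact_mono lY' H); last exact: leIr.
rewrite -disj_leC; apply/eqP/le_anti; rewrite le0x andbT.
have : phi (~` (a `&` e)) `&` phi e <= phi (~` a).
  rewrite -(DLC2 mphi) complI meetUl meetCx joinx0 (DLC2 mphi); exact: leIl.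
move=> le1; apply: (@le_trans _ _ (phi (~` a) `&` ~` phi (~` a))).
  rewrite lexI; apply/andP; split; last by apply: le_trans (leIl _ _) (leIr _ _).
  apply: le_trans le1; rewrite lexI leIr /=.
  by apply: le_trans (leIl _ _) _; apply: le_trans (leIl _ _) _.
by rewrite meetxC.
Qed.

Lemma DLC_well_inside a b : a ≪ b -> phi a ≪ phi b.
Proof.
move=> /DLC3_strong H.
by apply: (well_inside_mono lY') H _ => //; exact: DLC_compl_le.
Qed.

End MorphismTheory.

Section CompositionTheory.
Variables (X Y Z : contact_triple) (psi : Y -> Z) (phi : X -> Y).
Hypotheses (lX : is_CLCA X) (lY : is_CLCA Y) (lZ : is_CLCA Z).
Hypotheses (mpsi : is_DLC_morphism psi) (mphi : is_DLC_morphism phi).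

Let cZ := clca_complete lZ.
Let lX' := clca_lca lX.
Let lY' := clca_lca lY.
Let lZ' := clca_lca lZ.
Local Notation chi := (DLC_comp_fun psi phi).

Lemma DLC_comp_ge a b : bounded b -> b ≪ a -> psi (phi b) <= chi a.
Proof. by move=> Bb ba; apply: (bjoin_ub cZ); exists b. Qed.

Lemma DLC_comp_leP a u :
  (forall b, bounded b -> b ≪ a -> psi (phi b) <= u) -> chi a <= u.
Proof. by move=> H; apply: (bjoin_le cZ) => _ [b [Bb ba] <-]; exact: H. Qed.

Lemma DLC_comp_le a : chi a <= psi (phi a).
Proof.
apply: DLC_comp_leP => b _ /(well_inside_le lX') ba.
by apply: (DLC_mono mpsi); exact: (DLC_mono mphi).
Qed.

Lemma DLC_comp_ge_well_inside a b : a ≪ b -> psi (phi a) <= chi b.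
Proof.
move=> ab; rewrite (DLC5 mpsi); apply: (bjoin_le cZ) => _ [y [By ya] <-].
have [z [Bz yz]] := DLC4 mphi By.
apply: (@le_trans _ _ (psi (phi (z `&` a)))).
  apply: (DLC_mono mpsi); rewrite (DLC2 mphi) lexI yz.
  exact: (well_inside_le lY').
apply: DLC_comp_ge; first exact: bounded_meetl.
by apply: (well_inside_mono lX') ab _; rewrite ?leIr.
Qed.

Lemma DLC_comp_morphism : is_DLC_morphism chi.
Proof.
split.
- apply/le_anti; rewrite le0x andbT.
  by apply: le_trans (DLC_comp_le _) _; rewrite (DLC1 mphi) (DLC1 mpsi).
- move=> a b; apply/le_anti/andP; split.
    rewrite lexI; apply/andP; split; apply: DLC_comp_leP => c Bc H;
      apply: DLC_comp_ge => //; apply: (well_inside_mono lX') H _ => //;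
      rewrite ?leIl ?leIr //.
  apply: (bjoin_meet2 cZ) => _ _ [c [Bc ca] <-] [e [Be eb] <-].
  rewrite -(DLC2 mpsi) -(DLC2 mphi); apply: DLC_comp_ge.
    exact: bounded_meetl.
  by apply: well_inside_meet => //;
    [apply: (well_inside_mono lX') ca _|apply: (well_inside_mono lX') eb _];
    rewrite ?leIl ?leIr.
- move=> a b Ba ab.
  have [c [Bc ac cb]] := BC1 lX' Ba ab.
  have [e [Be ae ec]] := BC1 lX' Ba ac.
  have : ~` psi (~` (~` phi (~` e))) ≪ psi (phi c).
    exact: (DLC3_strong lY' lZ mpsi) (DLC3_strong lX' lY mphi ec).
  rewrite complK => H; apply: (well_inside_mono lZ') H _.
    rewrite leC; apply: DLC_comp_ge_well_inside; exact: well_inside_compl.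
  exact: DLC_comp_ge_well_inside.
- move=> b Bb.
  have [y [By yb]] := DLC4 mpsi Bb; have [a [Ba ya]] := DLC4 mphi By.
  have [c [Bc ac _]] := BC1 lX' Ba (@well_inside_top _ lX' a).
  exists c; split=> //; apply: (le_trans yb).
  by apply: le_trans (DLC_comp_ge_well_inside ac); exact: (DLC_mono mpsi).
- move=> a; apply/le_anti/andP; split.
    apply: DLC_comp_leP => b Bb ba.
    have [c [Bc bc ca]] := BC1 lX' Bb ba.
    apply: (le_trans (DLC_comp_ge_well_inside bc)).
    by apply: (bjoin_ub cZ); exists c.
  apply: (bjoin_le cZ) => _ [b [Bb ba] <-].
  exact: le_trans (DLC_comp_le _) (DLC_comp_ge Bb ba).
Qed.

End CompositionTheory.

Lemma DLC_id_morphism (X : contact_triple) :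
  is_CLCA X -> is_DLC_morphism (fun a : X => a).
Proof.
move=> [lX cX]; split=> // [a b _|b Bb|a]; first by rewrite complK.
  by exists b.
apply/le_anti/andP; split; last first.
  by apply: (bjoin_le cX) => _ [b [_ /(well_inside_le lX) ba] <-].
set s := bjoin _; rewrite -[s]complK -disj_leC; apply/negPn/negP.
move=> /(BC3 lX)[b [Bb /negP b0 H]]; apply: b0.
rewrite -lex0 -(meetxC s) lexI; apply/andP; split.
  apply: (bjoin_ub cX); exists b => //; split=> //.
  by apply: (well_inside_mono lX) H _; rewrite ?leIl.
by apply: le_trans (well_inside_le lX H) _; exact: leIr.
Qed.

Lemma DLC_hom_eq (X Y : CLCA) (f g : DLC_hom X Y) :
  (forall a, f a = g a) -> f = g.
Proof.
case: f g => [f fP] [g gP] /= /funext fg; case: _ / fg in gP *.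
by congr MkDLCHom; exact: Prop_irrelevance.
Qed.

Definition DLC_id (X : CLCA) : DLC_hom X X :=
  MkDLCHom (DLC_id_morphism (clcaP X)).

Definition DLC_comp (X Y Z : CLCA) (psi : DLC_hom Y Z) (phi : DLC_hom X Y) :
    DLC_hom X Z :=
  MkDLCHom (DLC_comp_morphism (clcaP X) (clcaP Y) (clcaP Z)
              (DLC_homP psi) (DLC_homP phi)).

Lemma DLC_comp_idl (X Y : CLCA) (f : DLC_hom X Y) : DLC_comp (DLC_id Y) f = f.
Proof. by apply: DLC_hom_eq => a; rewrite [RHS](DLC5 (DLC_homP f)). Qed.

Lemma DLC_comp_idr (X Y : CLCA) (f : DLC_hom X Y) : DLC_comp f (DLC_id X) = f.
Proof. by apply: DLC_hom_eq => a; rewrite [RHS](DLC5 (DLC_homP f)). Qed.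

Lemma DLC_comp_assoc (X Y Z T : CLCA)
    (h : DLC_hom Z T) (g : DLC_hom Y Z) (f : DLC_hom X Y) :
  DLC_comp h (DLC_comp g f) = DLC_comp (DLC_comp h g) f.
Proof.
have [[PX PY] [PZ PT]] := ((clcaP X, clcaP Y), (clcaP Z, clcaP T)).
have [Pf [Pg Ph]] := (DLC_homP f, (DLC_homP g, DLC_homP h)).
apply: DLC_hom_eq => a /=; apply/le_anti/andP; split.
  apply: (DLC_comp_leP PT) => b Bb ba.
  have [c [Bc bc ca]] := BC1 (clca_lca PX) Bb ba.
  apply: (@le_trans _ _ (h (g (f b)))).
    by apply: (DLC_mono Ph); apply: DLC_comp_le.
  apply: (@le_trans _ _ (DLC_comp h g (f c))).
    apply: DLC_comp_ge_well_inside => //.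
    exact: (DLC_well_inside (clca_lca PX) PY Pf).
  exact: (@DLC_comp_ge _ _ _ (DLC_comp h g) f PT).
apply: (DLC_comp_leP PT) => b Bb ba.
have [c [Bc bc ca]] := BC1 (clca_lca PX) Bb ba.
apply: (@le_trans _ _ (h (g (f b)))); first exact: DLC_comp_le.
apply: (@le_trans _ _ (h (DLC_comp g f c))).
  apply: (DLC_mono Ph); exact: DLC_comp_ge_well_inside.
exact: (@DLC_comp_ge _ _ _ h (DLC_comp g f) PT).
Qed.

Definition DLC : category :=
  Category DLC_comp_idl DLC_comp_idr DLC_comp_assoc.

(* Main.v *)
Require Import Defs.
From mathcomp Require Import all_boot all_order.
From mathcomp Require Import all_classical.

(** In a product triple both [≪] and suprema are computed coordinatewise, so
    the tuple [a |-> (f_g a)_g] of a source of morphisms inherits the axioms of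
    a morphism from its components; boundedness of finite support is what makes
    (DLC4) hold, by a finite join. Uniqueness comes from (DLC5): the composite
    of a projection with any morphism [k] is the corresponding component of
    [k], since (DLC5) exhibits that component as the supremum that defines the
    composite. *)

Set Implicit Arguments.
Unset Strict Implicit.
Unset Printing Implicit Defensive.

Import Order.Theory.
Local Open Scope classical_set_scope.
Local Open Scope order_scope.

Local Notation "a ≪ b" := (well_inside a b) (at level 70, no associativity).

(** Suprema are unique by antisymmetry, so any explicit one computes [bjoin]. On the empty set
    [supremum] falls back on its default [\bot], which is the right value there because every
    element is then an upper bound. *)
Lemma supremums_bjoin d (A : bPOrderType d) (S : set A) (u : A) :
  supremums S u -> bjoin S = u.
Proof.
move=> Su; rewrite /bjoin /supremum; case: ifPn => [/eqP S0|_].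
  by apply/le_anti; rewrite le0x /=; apply: Su.2; rewrite S0.
case: xgetP => [z _ Sz|/(_ u)//].
by apply/le_anti/andP; split; [apply: Sz.2 Su.1|apply: Su.2 Sz.1].
Qed.

(** Merges finitely many witnesses into one: induction along an enumeration of [D] joins them, and
    upward closure of [P t] keeps what was already achieved. *)
Lemma bounded_bigjoin d (A : bLatticeType d) (J : set A) (T : Type)
    (P : T -> A -> Prop) (D : set T) :
  is_ideal J -> finite_set D ->
  (forall t a b, P t a -> a <= b -> P t b) ->
  (forall t, D t -> exists a, J a /\ P t a) ->
  exists a, J a /\ forall t, D t -> P t a.
Proof.
move=> iJ finD Pmono HD.
have [s sD] : exists s : seq {classic T}, D = [set` s] by apply/finite_seqP.
rewrite sD in HD *; elim: s {D finD sD} HD => [|t s IH] HD.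
  by exists \bot; split=> //; exact: ideal_bot iJ.
have [a [Ja Pa]] := HD t (mem_head t s).
have [u us|b [Jb Pb]] := IH.
  by apply: HD; rewrite /= in_cons us orbT.
exists (a `|` b); split; first exact: ideal_join iJ _ _ Ja Jb.
move=> u; rewrite /= in_cons => /predU1P[->|us].
  by apply: Pmono Pa _; exact: leUl.
by apply: Pmono (Pb u us) _; exact: leUr.
Qed.

Section BooleanProductTheory.
Variables (I : Type) (d : I -> Order.disp_t).
Variable K : forall i, ctbDistrLatticeType (d i).
Implicit Types (x y : ba_prod K) (S : set (ba_prod K)).

Lemma ba_prod_leP x y : reflect (forall i, x i <= y i) (x <= y).
Proof. exact: asboolP. Qed.

Lemma ba_prod_neq0P x : reflect (exists i, x i != \bot) (x != \bot).
Proof.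
apply: (iffP idP) => [x0|[i]]; last by apply: contra_neq => ->.
apply: contrapT => H; case/eqP: x0; apply: functional_extensionality_dep => i.
by apply/eqP/negPn/negP => xi; apply: H; exists i.
Qed.

Lemma ba_prod_single i (a : K i) :
  exists x, x i = a /\ forall j, j <> i -> x j = \bot.
Proof.
(* The type of a coordinate depends on its index, so [a] must be transported along [i = j]; at
   [j = i] proof irrelevance makes the transport trivial. *)
exists (fun j => if pselect (i = j) is left e
                 then ecast k (K k) e a else \bot); split.
  by case: pselect => // e; rewrite (Prop_irrelevance e (erefl i)).
by move=> j ji; case: pselect => // ij; case: ji; rewrite ij.
Qed.

Lemma ba_prod_supremums S : (forall i, complete_lattice (K i)) ->
  supremums S ((fun i => bjoin [set x i | x in S]) : ba_prod K).
Proof.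
move=> cK; split=> [x Sx|y Sy]; apply/ba_prod_leP => i.
  by apply: (bjoin_ub (cK i)); exists x.
by apply: (bjoin_le (cK i)) => _ [x /Sy/ba_prod_leP xy <-]; exact: xy.
Qed.

Lemma bjoin_ba_prod S i : (forall i, complete_lattice (K i)) ->
  bjoin S i = bjoin [set x i | x in S].
Proof. by move=> cK; rewrite (supremums_bjoin (ba_prod_supremums S cK)). Qed.

End BooleanProductTheory.

Section ContactProductTheory.
Variables (I : Type) (A : I -> contact_triple).
Implicit Types a b c : lca_prod A.

Lemma lca_prod_well_inside a b : a ≪ b <-> forall i, a i ≪ b i.
Proof.
split=> [ab i ci|ab [i]]; last exact: ab.
by apply: ab; exists i.
Qed.

(** Lifts bounded elements of one factor to bounded elements of the product: the support lies in
    [[set i]], and [\bot] is bounded in the other factors. *)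
Lemma lca_prod_single i (x : A i) : (forall j, is_LCA (A j)) -> bounded x ->
  exists a, [/\ bounded a, a i = x & forall j, j <> i -> a j = \bot].
Proof.
move=> lA Bx; have [a [ai a0]] := ba_prod_single (K := fun j => ct_alg (A j)) x.
exists a; split=> //; split=> [j|].
  have [->|/a0 ->] := pselect (j = i); first by rewrite ai.
  exact: ideal_bot (lca_ideal (lA j)).
apply: (sub_finite_set (B := [set i])) => // j /= aj.
by apply: contrapT => /a0 aj0; rewrite aj0 eqxx in aj.
Qed.

Lemma lca_prod_LCA : (forall i, is_LCA (A i)) -> is_LCA (lca_prod A).
Proof.
move=> lA; split.
- split.
  + move=> a /ba_prod_neq0P[i ai]; exists i.
    exact: contact_refl (lca_contact (lA i)) _ ai.
  + move=> a b [i /(contact_neq0 (lca_contact (lA i)))[ai bi]].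
    by split; apply/ba_prod_neq0P; exists i.
  + by move=> a b [i /(contact_sym (lca_contact (lA i))) ab]; exists i.
  + move=> a b c; split.
      by move=> [i /(contact_join (lca_contact (lA i)))[]]; [left|right]; exists i.
    by case=> -[i abc]; exists i; apply/(contact_join (lca_contact (lA i)));
      [left|right].
- split.
  + split=> [i|]; first exact: ideal_bot (lca_ideal (lA i)).
    by apply: (sub_finite_set (B := set0)) => // i /=; rewrite eqxx.
  + move=> a b [Bb finb] /ba_prod_leP ab; split=> [i|].
      exact: ideal_down (lca_ideal (lA i)) _ _ (Bb i) (ab i).
    apply: sub_finite_set finb => i /=; apply: contra_neq => bi.
    by apply/eqP; rewrite -lex0 -bi.
  + move=> a b [Ba fina] [Bb finb]; split=> [i|].
      exact: ideal_join (lca_ideal (lA i)) _ _ (Ba i) (Bb i).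
    have finab : finite_set ([set i | a i != \bot] `|` [set i | b i != \bot]).
      by rewrite finite_setU.
    apply: sub_finite_set finab => i /=.
    by rewrite join_eq0 negb_and => /orP.
- move=> a c [Ba fina] /lca_prod_well_inside ac.
  (* Interpolants are chosen coordinate by coordinate. The last clause confines the support of the
     chosen tuple to that of [a], so that it stays finite. *)
  have H i : {b : A i |
      [/\ bounded b, a i ≪ b, b ≪ c i & a i = \bot -> b = \bot]}.
    apply: cid; have [ai|/eqP ai] := eqVneq (a i) \bot.
      exists \bot; split=> //; rewrite ?ai; try exact: bot_well_inside.
      exact: ideal_bot (lca_ideal (lA i)).
    by have [b [Bb ab bc]] := BC1 (lA i) (Ba i) (ac i); exists b.
  exists (fun i => sval (H i)); split.
  + split=> [i|]; first by have [] := svalP (H i).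
    apply: sub_finite_set fina => i /=; apply: contra_neq.
    by have [] := svalP (H i).
  + by apply/lca_prod_well_inside => i; have [] := svalP (H i).
  + by apply/lca_prod_well_inside => i; have [] := svalP (H i).
(* Contact in the product is witnessed by one coordinate, so a tuple supported there suffices. *)
- move=> a b [i /(BC2 (lA i))[x [Bx ax]]].
  have [c [Bc ci _]] := lca_prod_single lA Bx.
  by exists c; split=> //; exists i; rewrite -ci in ax.
- move=> a /ba_prod_neq0P[i /(BC3 (lA i))[x [Bx x0 xa]]].
  have [b [Bb bi b0]] := lca_prod_single lA Bx.
  exists b; split=> //; first by apply/ba_prod_neq0P; exists i; rewrite bi.
  apply/lca_prod_well_inside => j.
  have [->|/b0 ->] := pselect (j = i); first by rewrite bi.
  exact: bot_well_inside.
Qed.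

Hypothesis lA : forall i, is_CLCA (A i).

Let lA' i := clca_lca (lA i).
Let cA i := clca_complete (lA i).

Lemma lca_prod_CLCA : is_CLCA (lca_prod A).
Proof.
split; first exact: lca_prod_LCA.
by move=> S; eexists; exact: ba_prod_supremums.
Qed.

Lemma lca_proj_morphism i : is_DLC_morphism (@lca_proj I A i).
Proof.
split=> //.
(* Projections commute with complements, so only a double complement separates hypothesis and
   goal. *)
- move=> a b _ /lca_prod_well_inside /(_ i).
  by rewrite -{1}[a i]complK.
- move=> x Bx; have [a [Ba ai _]] := lca_prod_single lA' Bx.
  by exists a; rewrite /lca_proj ai.
(* By (DLC5) for the identity of [A i], [a i] is the join of the bounded elements well inside it.
   These are exactly the [i]-th coordinates of the bounded tuples well inside [a]: extend by [\bot],
   which is well inside everything. *)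
- move=> a; rewrite [LHS](DLC5 (DLC_id_morphism (lA i))); congr bjoin.
  apply/seteqP; split=> _ [x [Bx xa] <-]; last first.
    by exists (x i) => //; split; [exact: Bx.1|move/lca_prod_well_inside: xa].
  have [b [Bb bi b0]] := lca_prod_single lA' Bx.
  exists b => //; split=> //; apply/lca_prod_well_inside => j.
  have [->|/b0 ->] := pselect (j = i); first by rewrite bi.
  exact: bot_well_inside.
Qed.

Lemma lca_prod_tuple_morphism (X : contact_triple) (f : forall i, X -> A i) :
  is_LCA X -> (forall i, is_DLC_morphism (f i)) ->
  @is_DLC_morphism X (lca_prod A) (fun x i => f i x).
Proof.
move=> lX mf; split.
- by apply: functional_extensionality_dep => i; exact: DLC1 (mf i).
- by move=> a b; apply: functional_extensionality_dep => i; exact: DLC2 (mf i) _ _.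
- move=> a b Ba ab; apply/lca_prod_well_inside => i.
  exact: DLC3 (mf i) _ _ Ba ab.
- move=> b [Bb finb].
  have [i u v bu uv|i _|a [Ba ba]] := bounded_bigjoin
      (P := fun i (x : X) => b i <= f i x) (lca_ideal lX) finb.
  + by apply: le_trans bu _; exact: (DLC_mono (mf i)).
  + exact: DLC4 (mf i) _ (Bb i).
  exists a; split=> //; apply/ba_prod_leP => i.
  by have [->|/ba//] := eqVneq (b i) \bot; exact: le0x.
- move=> a; apply: functional_extensionality_dep => i.
  by rewrite bjoin_ba_prod // image_comp; exact: DLC5 (mf i) a.
Qed.

Lemma DLC_comp_fun_proj (X : contact_triple) (k : X -> lca_prod A) i (x : X) :
  is_DLC_morphism k -> DLC_comp_fun (@lca_proj I A i) k x = k x i.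
Proof. by move=> mk; rewrite (DLC5 mk x) bjoin_ba_prod // image_comp. Qed.

End ContactProductTheory.

Theorem proposition2p3 (Gamma : Type) (A : Gamma -> CLCA) :
  exists (prodP : is_CLCA (lca_prod A))
         (projP : forall g : Gamma, is_DLC_morphism (@lca_proj Gamma A g)),
    @is_product DLC Gamma A (MkCLCA prodP)
      (fun g => @MkDLCHom (MkCLCA prodP) (A g) (@lca_proj Gamma A g) (projP g)).
Proof.
have lA g : is_CLCA (A g) := clcaP (A g).
exists (lca_prod_CLCA lA), (lca_proj_morphism lA) => X f.
have mh := lca_prod_tuple_morphism lA (clca_lca (clcaP X))
  (fun g => DLC_homP (f g)).
exists (@MkDLCHom X (MkCLCA (lca_prod_CLCA lA)) _ mh); split.
  by move=> g; apply: DLC_hom_eq => a; exact: (DLC_comp_fun_proj lA g a mh).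
move=> k kf; apply: DLC_hom_eq => a; apply: functional_extensionality_dep => g.
(* Coordinate [g] of [k] is its composite with the projection, which [kf] identifies with [f g]. *)
rewrite /= -(kf g); exact: (DLC_comp_fun_proj lA g a (DLC_homP k)).
Qed.
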